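(* Let $t\ge 2$ be an integer and let $A$ be a column-$t$-partite zero-one matrix. Then $$\operatorname{ex}(n,A)<n^{2-\frac{1}{t}+\frac{1}{t^{2}}+o(1)},$$ that is, for every $\varepsilon>0$ there exists $n_0$ such that $\operatorname{ex}(n,A)<n^{2-\frac1t+\frac{1}{t^2}+\varepsilon}$ for all $n\ge n_0$.
   Context: A zero-one matrix $M$ contains a zero-one matrix $A$ if one can delete some rows and columns of $M$ and turn some $1$-entries into $0$-entries so that the resulting matrix is $A$. The weight of a matrix is its number of $1$-entries, and $\operatorname{ex}(n,A)$ is the maximum weight of an $n\times n$ zero-one matrix not containing $A$. A matrix is column-$t$-partite if its columns can be cut into $t$ consecutive intervals, giving $t$ submatrices, such that every row of each submatrix contains at most one $1$-entry. *)

(* Defs.v *)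
From mathcomp Require Import all_boot all_order all_algebra.
From Stdlib Require Import Reals.
Set Implicit Arguments. Unset Strict Implicit. Unset Printing Implicit Defensive.

Definition weight (m n : nat) (M : 'M[bool]_(m, n)) : nat :=
  #|[set ij : 'I_m * 'I_n | M ij.1 ij.2]|.

(* M contains A: delete rows/columns (strictly increasing row map f and column
   map g select the kept rows/columns) and turn some 1s into 0s *)
Definition containsb (m n k l : nat) (M : 'M[bool]_(m, n)) (A : 'M[bool]_(k, l)) : bool :=
  [exists f : {ffun 'I_k -> 'I_m}, exists g : {ffun 'I_l -> 'I_n},
    [&& [forall i : 'I_k, forall j : 'I_k, (i < j)%N ==> (f i < f j)%N],
        [forall i : 'I_l, forall j : 'I_l, (i < j)%N ==> (g i < g j)%N] &
        [forall i, forall j, A i j ==> M (f i) (g j)]]].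

Definition ex (n k l : nat) (A : 'M[bool]_(k, l)) : nat :=
  \max_(M : 'M[bool]_(n, n) | ~~ containsb M A) weight M.

(* column-t-partite: columns cut into t consecutive intervals (given by a
   nondecreasing assignment of columns to parts 0..t-1), such that every row
   of each part has at most one 1-entry *)
Definition column_partite (t k l : nat) (A : 'M[bool]_(k, l)) : Prop :=
  exists c : 'I_l -> 'I_t,
    (forall j1 j2 : 'I_l, (j1 <= j2)%N -> (c j1 <= c j2)%N) /\
    forall (i : 'I_k) (j1 j2 : 'I_l),
      A i j1 -> A i j2 -> c j1 = c j2 -> j1 = j2.

(* Main.v *)
Require Import Defs.
From mathcomp Require Import all_boot all_order all_algebra.
From Stdlib Require Import Reals.
(* [Reals] rebinds [^] on [nat] to [Nat.pow]; re-importing [ssrnat] restores [expn]. *)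
From mathcomp Require Import ssrnat zify.
From Stdlib Require Import Lra.
Set Implicit Arguments. Unset Strict Implicit. Unset Printing Implicit Defensive.

(* Count S(I), the number of pairs of a t-tuple R of rows in the interval I and
   a t-tuple T of columns such that R x T spans only 1-entries. Cut I into K
   blocks. If M avoids A, then the t-tuples of columns with a common row in at
   least k of the blocks have small density in every large U^t: by a positive
   density form of Erdos's theorem on t-partite hypergraphs they would otherwise
   contain a product C_1 x ... x C_t of large sets, all of whose tuples hit the
   same k blocks; thinning out the C_s to make them separated, one finds A.
   Applying this to U = N(R) for all R, most of S(I) comes from tuples T whose
   common rows lie in fewer than k blocks, so S(I) <= c * sum_j S(I_j) with c
   independent of K, and some block has S(I_j) >= S(I) / (c K). Repeating this
   log_K n times ends in a single row, where S <= n^t, hence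
   S([n]) <= (cK)^(log_K n) n^t = n^(t + 1 + o(1)) when K is large. On the other
   hand S([n]) >= w^(t^2) / n^(2t(t-1)) for w the weight of M, by convexity.
   The case where most R have a bounded N(R) yields the better bound
   w = O(n^(2 - 1/t)). *)

(** * Power means *)

(** Over the integers this is [(b - a) * (b ^ q - a ^ q) >= 0] multiplied out. *)
Lemma chebyshev_pair (a b q : nat) : a * b ^ q + b * a ^ q <= a ^ q.+1 + b ^ q.+1.
Proof.
wlog leab : a b / a <= b => [H|].
  by case/orP: (leq_total a b) => /H //; rewrite addnC [leqRHS]addnC.
have le_q : a ^ q <= b ^ q by elim: q => // q IH; rewrite !expnS leq_mul.
rewrite !expnS -(subnKC leab) in le_q *; rewrite -(subnKC le_q); nia.
Qed.

Lemma power_mean (I : finType) (P : {pred I}) (a : I -> nat) (q : nat) :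
  (\sum_(i in P) a i) ^ q.+1 <= #|P| ^ q * \sum_(i in P) a i ^ q.+1.
Proof.
(* Chebyshev's sum inequality: after doubling, the pairs [(i, j)] and [(j, i)] together reduce it to
   [chebyshev_pair]. *)
have cheb p : (\sum_(i in P) a i) * (\sum_(i in P) a i ^ p) <= #|P| * \sum_(i in P) a i ^ p.+1.
  rewrite -(leq_pmul2l (isT : 0 < 2)) !mul2n -!addnn.
  rewrite {2}[(\sum_(i in P) a i) * _]mulnC !big_distrlr /= -big_split /=.
  rewrite -[#|P|]sum1_card !big_distrlr /= [X in _ <= _ + X]exchange_big /= -big_split /=.
  apply: leq_sum => i _; rewrite -!big_split /=; apply: leq_sum => j _.
  by rewrite !mul1n [a i ^ p * _]mulnC addnC; move: (chebyshev_pair (a j) (a i) p); lia.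
elim: q => [|q IH]; first by rewrite expn0 mul1n.
rewrite expnS; apply: (leq_trans (leq_mul (leqnn _) IH)).
by rewrite mulnCA expnSr -mulnA leq_mul.
Qed.

(** * Product sets in dense families of tuples *)

Section FunCons.
Variables (V : finType) (t : nat).

Definition fcons (x : V) (T : {ffun 'I_t -> V}) : {ffun 'I_t.+1 -> V} :=
  [ffun i => if unlift ord0 i is Some j then T j else x].

Lemma fcons0 x T : fcons x T ord0 = x.
Proof. by rewrite ffunE unlift_none. Qed.

Lemma fconsS x T j : fcons x T (lift ord0 j) = T j.
Proof. by rewrite ffunE liftK. Qed.

Lemma fcons_eta (T : {ffun 'I_t.+1 -> V}) : T = fcons (T ord0) [ffun j => T (lift ord0 j)].
Proof. by apply/ffunP => i; rewrite ffunE; case: unliftP => [j ->|->] //; rewrite ffunE. Qed.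

Lemma card_fcons (P : {pred {ffun 'I_t.+1 -> V}}) :
  #|P| = \sum_T #|[set x | fcons x T \in P]|.
Proof.
rewrite -sum1_card.
under [RHS]eq_bigr => T _ do rewrite -sum1_card.
rewrite pair_big_dep /=.
rewrite (reindex_onto (fun p : {ffun 'I_t -> V} * V => fcons p.2 p.1)
  (fun T => ([ffun j => T (lift ord0 j)], T ord0))) /=; last by move=> T _; rewrite -fcons_eta.
apply: eq_bigl => -[T x] /=; rewrite inE xpair_eqE fcons0 eqxx andbT.
suff -> : [ffun j => fcons x T (lift ord0 j)] == T by rewrite andbT.
by apply/eqP/ffunP => j; rewrite ffunE fconsS.
Qed.
End FunCons.

Lemma sum_threshold (I : finType) (P : {pred I}) (a : I -> nat) (b c s : nat) :
  (forall i, i \in P -> a i <= b) -> s <= \sum_(i in P) a i ->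
  s <= #|[set i in P | c <= a i]| * b + #|P| * c.
Proof.
move=> ab; move/leq_trans; apply.
rewrite (bigID (fun i => c <= a i)) /= leq_add //.
  rewrite -sum_nat_const (eq_bigl (fun i => i \in [set i in P | c <= a i])); last by move=> i; rewrite inE.
  by apply: leq_sum => i; rewrite inE => /andP[/ab].
rewrite -sum_nat_const.
rewrite [leqRHS](bigID (fun i => c <= a i)) /=.
by apply: (leq_trans _ (leq_addl _ _)); apply: leq_sum => i /andP[_]; rewrite -ltnNge => /ltnW.
Qed.

(** Since [4 * d * l <= u], each of the [l] factors in the falling factorial of [u %/ (2 * d)] is
    still at least [u / (4 * d)], while those for [u] are at most [u]. *)
Lemma bin_ratio (u d l : nat) : 4 * d * l <= u -> 0 < d ->
  'C(u, l) <= (4 * d) ^ l * 'C(u %/ (2 * d), l).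
Proof.
move=> ul d0; rewrite -(leq_pmul2r (fact_gt0 l)) -mulnA !bin_ffact.
have : 2 * d * (u %/ (2 * d)).+1 >= u by rewrite mulnC; apply/ltnW/ltn_ceil; lia.
set a := u %/ _ => ua.
have up : forall p, u ^_ p <= u ^ p.
  by elim=> // p IH; rewrite ffactnSr expnSr leq_mul // leq_subr.
have dn : forall p, p <= l -> (a.+1 - l) ^ p <= a ^_ p.
  elim=> // p IH pl; rewrite ffactnSr expnSr leq_mul //; first by apply: IH; lia.
  lia.
apply: (leq_trans (up l)); apply: (@leq_trans ((4 * d) ^ l * (a.+1 - l) ^ l)); last by rewrite leq_mul // dn.
rewrite -expnMn; case: (posnP l) => [->|l0]; first by rewrite !expn0.
by rewrite leq_exp2r //; nia.
Qed.

Lemma average_ge (I : finType) (P : {pred I}) (a : I -> nat) (b : nat) :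
  0 < #|P| -> #|P| * b <= \sum_(i in P) a i -> exists2 i, i \in P & b <= a i.
Proof.
move=> P0 le_sum.
case: (boolP [exists i in P, b <= a i]) => [/exists_inP //|].
rewrite negb_exists => /forallP no_i.
have lt_ab i : i \in P -> ~~ (b <= a i) by move=> iP; have := no_i i; rewrite iP.
have /card_gt0P[i iP] := P0; have := lt_ab i iP; rewrite -ltnNge => aib.
suff : \sum_(i in P) a i <= #|P| * b.-1 by nia.
rewrite -sum_nat_const; apply: leq_sum => j /lt_ab; rewrite -ltnNge; lia.
Qed.

(** Erdos's induction on [t]: many shorter tuples [T] have a large set [G T] of extensions, and
    averaging over all [l]-subsets [X] of [U] finds one that lies in [G T] for a positive proportion
    of them. This [X] becomes the first set. *)
Lemma blowup (t l d : nat) : 0 < d -> exists u0, forall (V : finType) (U : {set V})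
    (F : pred {ffun 'I_t -> V}),
  u0 <= #|U| -> #|U| ^ t <= d * #|[set T in ffun_on U | F T]| ->
  exists C : 'I_t -> {set V}, (forall s, #|C s| = l) /\
    forall T : {ffun 'I_t -> V}, (forall s, T s \in C s) -> F T.
Proof.
elim: t d => [|t IH] d d0.
  exists 0 => V U F _; rewrite expn0 => cF.
  have : 0 < #|[set T in ffun_on U | F T]| by nia.
  case/card_gt0P => T0; rewrite inE => /andP[_ FT0].
  exists (fun=> set0); split=> [[]//|T _]; suff -> : T = T0 by [].
  by apply/ffunP => -[].
(* Density lost in one step: [2 * d] for keeping only tuples with at least [u %/ (2 * d)]
   extensions, [(4 * d) ^ l] from [bin_ratio]. *)
have d'0 : 0 < 2 * d * (4 * d) ^ l by rewrite !muln_gt0 d0 expn_gt0; lia.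
have [u0 IHu] := IH _ d'0.
exists (u0 + 4 * d * l + l).+1 => V U F ule cF; set u := #|U| in ule cF *.
pose G (T : {ffun 'I_t -> V}) := [set x in U | F (fcons x T)].
pose c := u %/ (2 * d).
pose Z := [set T in ffun_on U | c <= #|G T|].
have cZ : u ^ t <= 2 * d * #|Z|.
  have GU T : T \in ffun_on U -> #|G T| <= u.
    by move=> _; apply: subset_leq_card; apply/subsetP => x; rewrite inE => /andP[].
  have : #|[set T in ffun_on U | F T]| <= \sum_(T in ffun_on U) #|G T|.
    rewrite card_fcons [leqRHS]big_mkcond; apply: leq_sum => T _.
    case: ifPn => [TU|].
      apply: subset_leq_card; apply/subsetP => x; rewrite !inE => /andP[/ffun_onP /(_ ord0)].
      by rewrite fcons0 => -> ->.
    apply: contraNT; rewrite -ltnNge => /card_gt0P[x]; rewrite !inE => /andP[/ffun_onP xTU _].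
    by apply/ffun_onP => j; have := xTU (lift ord0 j); rewrite fconsS.
  move=> /(sum_threshold c GU); rewrite -/Z card_ffun_on card_ord -/u => cle.
  have u_gt0 : 0 < u by lia.
  have cd : 2 * d * c <= u by rewrite mulnC leq_divM.
  rewrite expnSr in cF; rewrite -(leq_pmul2r u_gt0); nia.
pose D := [set X : {set V} | X \subset U & #|X| == l].
have cD : #|D| = 'C(u, l) by rewrite cards_draws.
have D0 : 0 < #|D| by rewrite cD bin_gt0; lia.
(* Double counting of the pairs [(X, T)] with [X] inside [G T]. *)
have sumX : #|D| * u ^ t <= \sum_(X in D) 2 * d * (4 * d) ^ l * #|[set T in Z | X \subset G T]|.
  rewrite -big_distrr /=.
  under eq_bigr => X _ do rewrite -sum1_card.
  have -> : \sum_(X in D) \sum_(T in [set T in Z | X \subset G T]) 1 =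
     \sum_(T in Z) #|[set X : {set V} | X \subset G T & #|X| == l]|.
    rewrite (exchange_big_dep (mem Z)) /=; last by move=> X T _; rewrite inE => /andP[].
    apply: eq_bigr => T TZ; rewrite -sum1_card; apply: eq_bigl => X.
    rewrite [in RHS]inE inE [X in _ && X]inE TZ /= andbC; case XG: (X \subset G T) => //=.
    suff -> : X \subset U by [].
    by apply: (subset_trans XG); apply/subsetP => x; rewrite inE => /andP[].
  apply: (@leq_trans (2 * d * (4 * d) ^ l * \sum_(T in Z) 'C(c, l))); last first.
    rewrite leq_mul //; apply: leq_sum => T; rewrite inE cards_draws => /andP[_].
    exact: leq_bin2l.
  rewrite sum_nat_const cD.
  have := @bin_ratio u d l _ d0; rewrite -/c => /(_ _) b.
  apply: (@leq_trans ((4 * d) ^ l * 'C(c, l) * (2 * d * #|Z|))); first by rewrite leq_mul // b; lia.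
  by rewrite leq_eqVlt; apply/orP; left; apply/eqP; nia.
have [X XD cX] := average_ge D0 sumX.
have [||C [cC CF]] := IHu V U (fun T => X \subset G T).
- lia.
- apply: (leq_trans cX); rewrite leq_mul //; apply: subset_leq_card; apply/subsetP => T.
  by rewrite !inE => /andP[/andP[-> _] ->].
exists (fun s => if unlift ord0 s is Some j then C j else X); split=> [s|T TC].
  by case: unliftP => [j _|_]; [exact: cC | move: XD; rewrite inE => /andP[_ /eqP]].
rewrite (fcons_eta T); set T' := [ffun j => _].
have XT' : X \subset G T'.
  by apply: CF => s; rewrite ffunE; have := TC (lift ord0 s); rewrite liftK.
have /(subsetP XT') : T ord0 \in X by have := TC ord0; rewrite unlift_none.
by rewrite inE => /andP[].
Qed.

(** * Separated sets of columns *)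

(* Repeatedly split off the set that first accumulates [l] elements. *)
Lemma separate (n l t : nat) (C : 'I_t -> {set 'I_n}) (P : {set 'I_t}) (x : nat) :
  (forall s, s \in P -> #|P| * l <= #|[set v in C s | x <= v]|) ->
  exists (sigma : seq 'I_t) (D : 'I_t -> {set 'I_n}),
  [/\ uniq sigma, sigma =i P,
    (forall s, s \in P -> [/\ D s \subset C s, l <= #|D s| & forall v, v \in D s -> x <= v]) &
    pairwise (fun s s' => [forall v in D s, forall w in D s', v < w]) sigma].
Proof.
move cP : #|P| => p; elim: p => [|p IH] in P cP x *.
  move: cP => /eqP; rewrite cards_eq0 => /eqP -> _.
  by exists [::], C; split=> // s; rewrite inE.
move=> large.
pose A z s := [set v in C s | x <= v < z].
have exz : exists z, [exists s in P, l <= #|A z s|].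
  have /card_gt0P[s sP] : 0 < #|P| by rewrite cP.
  exists n; apply/exists_inP; exists s => //.
  apply: (@leq_trans #|[set v in C s | x <= v]|); first by apply: leq_trans (large s sP); rewrite leq_pmull.
  by apply: subset_leq_card; apply/subsetP => v; rewrite !inE ltn_ord andbT.
case: (ex_minnP exz) => z /exists_inP[s sP ls] zmin.
(* By minimality of [z], moving the start from [x] to [z] costs each set at most [l] elements, so
   the size hypothesis survives for [P :\ s]. *)
have small s' : s' \in P -> #|A z s'| <= l.
  move=> s'P; case: z {ls} zmin => [|z] zmin.
    suff -> : A 0 s' = set0 by rewrite cards0.
    by apply/setP => v; rewrite !inE ltn0 !andbF.
  have : #|A z s'| < l.
    rewrite ltnNge; apply/negP => lA.
    have /zmin : [exists s in P, l <= #|A z s|] by apply/exists_inP; exists s'.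
    by rewrite ltnn.
  apply: leq_trans; case: (ltnP z n) => [zn|nz].
    apply: leq_trans (_ : #|Ordinal zn |: A z s'| <= _); last by rewrite cardsU1 -add1n leq_add2r leq_b1.
    apply: subset_leq_card; apply/subsetP => v; rewrite !inE -val_eqE /=.
    by case: (v \in C s') => //=; case: (x <= v) => //=; rewrite ltnS leq_eqVlt orbC => /orP[->|->]; rewrite ?orbT.
  apply: leqW; apply: subset_leq_card; apply/subsetP => v; rewrite !inE.
  by case: (v \in C s') => //=; case: (x <= v) => //= _; apply: leq_trans (ltn_ord v) nz.
have xz s' v : v \in A z s' -> x <= v < z by rewrite inE => /andP[].
have cP' : #|P :\ s| = p by have := cardsD1 s P; rewrite sP cP; lia.
have [|sg [D [usg sgP DP pw]]] := IH (P :\ s) cP' (maxn x z).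
  move=> s' /setD1P[ne s'P].
  have := large s' s'P; have := small s' s'P.
  have -> : [set v in C s' | x <= v] = A z s' :|: [set v in C s' | maxn x z <= v].
    apply/setP => v; rewrite !inE geq_max; case: (v \in C s') => //=; case: (x <= v) => //=.
    by case: ltnP.
  rewrite cardsU; lia.
exists (s :: sg), (fun s' => if s' == s then A z s else D s'); split.
- by rewrite /= usg sgP !inE eqxx.
- by move=> s'; rewrite !inE sgP !inE; case: eqP => [->|].
- move=> s' s'P; case: eqP => [->|/eqP ne].
    split=> //; first by apply/subsetP => v; rewrite inE => /andP[].
    by move=> v /xz /andP[].
  have [|DC lD Dx] := DP s'; first by rewrite !inE ne.
  by split=> // v /Dx; rewrite geq_max => /andP[].
- rewrite /= eqxx; apply/andP; split.
    apply/allP => s'; rewrite sgP => s'P; case/setD1P: (s'P) => ne s'P'; rewrite (negbTE ne).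
    have [_ _ Dx] := DP s' s'P.
    apply/forall_inP => v /xz /andP[_ vz]; apply/forall_inP => w /Dx.
    by rewrite geq_max => /andP[_]; apply: leq_trans.
  apply/(pairwiseP s) => i j; rewrite !inE => il jl ij.
  have ne i0 : i0 < size sg -> nth s sg i0 == s = false.
    by move=> /(mem_nth s); rewrite sgP => /setD1P[/negbTE].
  rewrite !ne //; have := (pairwiseP s) pw i j; rewrite !inE; exact.
Qed.

Lemma enum_val_lt (n : nat) (P : {pred 'I_n}) (i j : 'I_#|P|) :
  i < j -> enum_val i < enum_val j.
Proof.
move=> lt_ij; have x0 := enum_val i.
have srt : sorted (fun x y : 'I_n => x < y) (enum P).
  rewrite /enum_mem -enumT; apply: sorted_filter; first by move=> ? ? ?; apply: ltn_trans.
  by rewrite -(@sorted_map _ _ (@nat_of_ord n) ltn) val_enum_ord iota_ltn_sorted.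
rewrite !(enum_val_nth x0); apply: (sorted_ltn_nth _ x0 srt) => //; rewrite ?inE -?cardE //.
by move=> ? ? ?; apply: ltn_trans.
Qed.

(** * Counting all-ones pairs of tuples *)

Section Counting.
Variables (n t : nat) (M : 'M[bool]_n).
Implicit Types (I : {set 'I_n}) (T R : {ffun 'I_t -> 'I_n}).

Definition common_rows I T : {set 'I_n} := [set r in I | [forall s, M r (T s)]].
Definition common_cols R : {set 'I_n} := [set v | [forall i, M (R i) v]].

(* S(I): each power counts the t-tuples of rows, repetitions allowed, that are
   joined to all of T. *)
Definition cliques I : nat := \sum_T #|common_rows I T| ^ t.

Lemma sum_common_rows I (P : pred {ffun 'I_t -> 'I_n}) :
  \sum_(T | P T) #|common_rows I T| ^ t =
  \sum_(R in ffun_on I) #|[set T in ffun_on (common_cols R) | P T]|.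
Proof.
under [RHS]eq_bigr => R _ do rewrite -sum1_card.
rewrite (exchange_big_dep P) /=; last by move=> R T _; rewrite inE => /andP[].
apply: eq_bigr => T PT; rewrite -[X in _ ^ X](card_ord t) -card_ffun_on -sum1_card.
apply: eq_bigl => R; rewrite [X in _ = _ && X]inE PT andbT; apply/ffun_onP/andP.
  move=> RT; split; apply/ffun_onP => i; first by have := RT i; rewrite inE => /andP[].
  by rewrite inE; apply/forallP => j; have := RT j; rewrite inE => /andP[_ /forallP].
move=> [/ffun_onP RI /ffun_onP TR] i; rewrite inE RI; apply/forallP => s.
by have := TR s; rewrite inE => /forallP.
Qed.

Lemma cliquesE I : cliques I = \sum_(R in ffun_on I) #|common_cols R| ^ t.
Proof.
rewrite /cliques sum_common_rows; apply: eq_bigr => R _.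
rewrite -[X in _ ^ X](card_ord t) -card_ffun_on; apply: eq_card => T.
by rewrite !inE andbT.
Qed.
End Counting.

(** * Embedding [A] *)

(** A row of [A] has at most one 1-entry in each part, so a single tuple [T] takes care of it: use
    the columns of these entries and anything in the other sets. A common row of [T] in the block
    reserved for that row is its image. *)
Lemma blowup_contains (n t k l K : nat) (M : 'M[bool]_n) (A : 'M[bool]_(k, l))
    (B : 'I_K -> {set 'I_n}) (J : {set 'I_K}) (C : 'I_t -> {set 'I_n}) :
  column_partite t A ->
  (forall (j j' : 'I_K) (r r' : 'I_n), j < j' -> r \in B j -> r' \in B j' -> r < r') ->
  #|J| = k -> (forall s, #|C s| = t * l.+1) ->
  (forall T : {ffun 'I_t -> 'I_n}, (forall s, T s \in C s) ->
     forall j, j \in J -> common_rows M (B j) T != set0) ->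
  containsb M A.
Proof.
move=> [c [c_mono c_inj]] Bmono cJ cC hit.
(* The successor in [l.+1] keeps each [D s] nonempty even when [l = 0]. *)
have [|sg [D [usg sgP DP pw]]] := @separate n l.+1 t C setT 0.
  by move=> s _; rewrite cardsT card_ord -(cC s); apply: subset_leq_card; apply/subsetP => v; rewrite inE => ->.
have ssg : size sg = t.
  by rewrite -(card_uniqP usg) -[RHS](card_ord t); apply: eq_card => s; rewrite sgP !inE.
pose sgt := @Tuple t 'I_t sg (introT eqP ssg).
have sg_inj : injective (tnth sgt) by apply/tuple_uniqP.
have sorted_D (p p' : 'I_t) v w : p < p' -> v \in D (tnth sgt p) -> w \in D (tnth sgt p') -> v < w.
  move=> pp' vD wD; have := (pairwiseP (tnth sgt p)) pw p p'; rewrite !inE ssg !ltn_ord.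
  move=> /(_ isT isT pp') /forall_inP H.
  rewrite (tnth_nth (tnth sgt p)) in vD; rewrite (tnth_nth (tnth sgt p)) in wD.
  by have /forall_inP := H v vD; apply.
have lD s : l < #|D s| by have [] := DP s (in_setT s).
have DC s : D s \subset C s by have [] := DP s (in_setT s).
have jD (j : 'I_l) : j < #|D (tnth sgt (c j))| by apply: ltn_trans (lD _).
(* The parts of [A] go in order to the sets listed by [sg]; inside its set, column [j] takes the
   element of rank [j]. *)
pose g j := enum_val (Ordinal (jD j)).
have gD j : g j \in D (tnth sgt (c j)) by apply: enum_valP.
have g_mono (j j' : 'I_l) : j < j' -> g j < g j'.
  move=> jj'; have := c_mono j j' (ltnW jj'); rewrite leq_eqVlt => /orP[/eqP/val_inj cc|cc].
    rewrite /g; move: (jD j) (jD j'); rewrite cc => h h'; exact: enum_val_lt.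
  exact: sorted_D cc (gD j) (gD j').
pose Jrow (i : 'I_k) : 'I_K := enum_val (cast_ord (esym cJ) i).
have fE i : exists r, r \in B (Jrow i) /\ forall j, A i j -> M r (g j).
  have TE s : exists v, v \in D s /\ forall j, A i j -> tnth sgt (c j) = s -> v = g j.
    case: (pickP (fun j => A i j && (tnth sgt (c j) == s))) => [j /andP[Aj /eqP <-]|no].
      by exists (g j); split=> // j' Aj' /sg_inj cc; congr (g _); apply: c_inj Aj Aj' _.
    have /card_gt0P[v vD] : 0 < #|D s| by apply: leq_ltn_trans (lD s).
    by exists v; split=> // j Aj sj; have := no j; rewrite Aj sj eqxx.
  have [T TP] := fin_all_exists TE.
  have /set0Pn[r] : common_rows M (B (Jrow i)) [ffun s => T s] != set0.
    apply: hit; last exact: enum_valP.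
    by move=> s; rewrite ffunE; have [/(subsetP (DC s))] := TP s.
  rewrite inE => /andP[rB /forallP Mr]; exists r; split=> // j Aj.
  by have := Mr (tnth sgt (c j)); rewrite ffunE; have [_ H] := TP (tnth sgt (c j)); rewrite (H j).
have [f fP] := fin_all_exists fE.
apply/existsP; exists [ffun i => f i]; apply/existsP; exists [ffun j => g j].
apply/and3P; split.
- apply/forallP => i; apply/forallP => j; apply/implyP => ij; rewrite !ffunE.
  by apply: (Bmono (Jrow i) (Jrow j)); [exact: enum_val_lt|have [] := fP i|have [] := fP j].
- apply/forallP => i; apply/forallP => j; apply/implyP => ij; rewrite !ffunE; exact: g_mono.
- apply/forallP => i; apply/forallP => j; apply/implyP => Aij; rewrite !ffunE.
  by have [_] := fP i; apply.
Qed.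

(** * Descent through blocks of rows *)

(** The end [a + h] may exceed [n], so that lengths can be exact powers of [K]. *)
Definition block (n a h : nat) : {set 'I_n} := [set r : 'I_n | a <= r < a + h].
Arguments block : clear implicits.

Lemma card_block (n a h : nat) : #|block n a h| <= h.
Proof.
rewrite cardE -(size_map (@nat_of_ord n)) -[leqRHS](size_iota a h); apply: uniq_leq_size.
  by rewrite (map_inj_uniq val_inj) enum_uniq.
by move=> r /mapP[i]; rewrite mem_enum inE => ai ->; rewrite mem_iota.
Qed.

Lemma block_split (n a h K : nat) (r : 'I_n) : r \in block n a (K * h) ->
  exists j : 'I_K, r \in block n (a + j * h) h.
Proof.
rewrite inE => /andP[ar rK].
have h0 : 0 < h by case: h rK => // ; rewrite muln0; lia.
have jK : (r - a) %/ h < K by rewrite ltn_divLR //; lia.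
exists (Ordinal jK); rewrite inE /=.
have := divn_eq (r - a) h; have := ltn_pmod (r - a) h0; lia.
Qed.

Lemma leq_card_bigcup (I T : finType) (P : pred I) (F : I -> {set T}) :
  #|\bigcup_(i | P i) F i| <= \sum_(i | P i) #|F i|.
Proof.
apply: (big_ind2 (fun (X : {set T}) m => #|X| <= m)) => [|X m Y p Xm Yp|//]; first by rewrite cards0.
by apply: leq_trans (leq_card_setU X Y) _; apply: leq_add.
Qed.

(** In the loss factor, 2 pays for discarding bad tuples, [k.+1 ^ t.-1] for the power mean over
    fewer than [k] blocks, and [K] for averaging over blocks. The successor keeps the factor
    positive when [k = 0]. *)
Lemma cliques_block_step (t k l K : nat) (A : 'M[bool]_(k, l)) :
  0 < t -> 0 < K -> column_partite t A ->
  exists D, forall (n : nat) (M : 'M[bool]_n) (a h : nat), ~~ containsb M A ->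
    D * (K * h) ^ t <= cliques t M (block n a (K * h)) ->
    exists a', cliques t M (block n a (K * h)) <=
      2 * k.+1 ^ t.-1 * K * cliques t M (block n a' h).
Proof.
move=> t0 K0 Apart.
(* [2 ^ K] pays for the union bound over the sets [J] of [k] blocks; the 4 leaves at most a quarter
   of the tuples bad. *)
have d0 : 0 < 4 * 2 ^ K by rewrite muln_gt0 expn_gt0.
have [u0 blow] := @blowup t (t * l.+1) _ d0.
exists (4 * u0 ^ t) => n M a h Afree; set I := block n a (K * h) => large.
pose B (j : 'I_K) := block n (a + j * h) h.
pose hit (T : {ffun 'I_t -> 'I_n}) := [set j | common_rows M (B j) T != set0].
pose good (T : {ffun 'I_t -> 'I_n}) := #|hit T| < k.
have few_bad R : 4 * #|[set T in ffun_on (common_cols M R) | ~~ good T]| <=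
    4 * u0 ^ t + #|common_cols M R| ^ t.
  set U := common_cols M R.
  case: (ltnP #|U| u0) => [small|big].
    apply: leq_trans (leq_addr _ _); rewrite leq_mul2l /=.
    apply: (@leq_trans (#|U| ^ t)); last by rewrite leq_exp2r // ltnW.
    rewrite -[X in _ ^ X](card_ord t) -card_ffun_on.
    by apply: subset_leq_card; apply/subsetP => T; rewrite inE => /andP[].
  apply: leq_trans (leq_addl _ _).
  pose F (J : {set 'I_K}) := [set T in ffun_on U | J \subset hit T].
  have bad_cover : #|[set T in ffun_on U | ~~ good T]| <= \sum_(J : {set 'I_K} | #|J| == k) #|F J|.
    apply: leq_trans (_ : #|\bigcup_(J : {set 'I_K} | #|J| == k) F J| <= _); last first.
      by apply: leq_card_bigcup.
    apply: subset_leq_card; apply/subsetP => T; rewrite inE /good -leqNgt => /andP[TU].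
    move=> /card_geqP[s [us ss sh]].
    apply/bigcupP; exists [set j in s]; first by rewrite cardsE (card_uniqP us) ss.
    by rewrite inE TU; apply/subsetP => j; rewrite inE => /sh.
  have smallF (J : {set 'I_K}) : #|J| == k -> 4 * 2 ^ K * #|F J| <= #|U| ^ t.
    move=> /eqP cJ; rewrite leqNgt; apply/negP => bigF.
    have [C [cC CF]] := blow _ U (fun T => J \subset hit T) big (ltnW bigF).
    move/negP: Afree; apply; apply: (blowup_contains (B := B) Apart _ cJ cC).
      move=> j j' r r' jj'; rewrite !inE; nia.
    by move=> T /CF /subsetP JT j /JT; rewrite inE.
  rewrite -(leq_pmul2l (_ : 0 < 2 ^ K)) ?expn_gt0 // mulnA [_ * 4]mulnC.
  apply: (leq_trans (leq_mul (leqnn _) bad_cover)); rewrite big_distrr /=.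
  apply: (@leq_trans (\sum_(J : {set 'I_K} | #|J| == k) #|U| ^ t)).
    by apply: leq_sum => J; apply: smallF.
  rewrite sum_nat_cond_const leq_mul //.
  by apply: leq_trans (max_card _) _; rewrite -cardsT -powersetT card_powerset cardsT card_ord.
(* By [large], the term [4 * u0 ^ t * (K * h) ^ t] from small neighbourhoods is at most
   [cliques t M I], so bad tuples carry at most half of the count. *)
have good_half : cliques t M I <= 2 * \sum_(T | good T) #|common_rows M I T| ^ t.
  have : 4 * \sum_(T | ~~ good T) #|common_rows M I T| ^ t <=
      4 * u0 ^ t * (K * h) ^ t + cliques t M I.
    rewrite sum_common_rows big_distrr /=; apply: (@leq_trans (\sum_(R in ffun_on I) (4 * u0 ^ t + #|common_cols M R| ^ t))).
      by apply: leq_sum => R _; apply: few_bad.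
    rewrite big_split /= -cliquesE leq_add2r sum_nat_const mulnC leq_mul //.
    by rewrite card_ffun_on card_ord leq_exp2r // card_block.
  have : cliques t M I = \sum_(T | good T) #|common_rows M I T| ^ t +
     \sum_(T | ~~ good T) #|common_rows M I T| ^ t by rewrite /cliques (bigID good).
  lia.
have good_split : \sum_(T | good T) #|common_rows M I T| ^ t <=
    k.+1 ^ t.-1 * \sum_j cliques t M (B j).
  rewrite exchange_big /= big_distrr /= [leqRHS](bigID good) /=.
  apply: leq_trans (leq_addr _ _); apply: leq_sum => T gT.
  have cover : #|common_rows M I T| <= \sum_(j in hit T) #|common_rows M (B j) T|.
    apply: leq_trans (_ : #|\bigcup_(j in hit T) common_rows M (B j) T| <= _); last exact: leq_card_bigcup.
    apply: subset_leq_card; apply/subsetP => r; rewrite inE => /andP[/block_split[j rj] rT].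
    have rjT : r \in common_rows M (B j) T by rewrite inE rj.
    by apply/bigcupP; exists j => //; rewrite inE; apply/set0Pn; exists r.
  have := power_mean (mem (hit T)) (fun j => #|common_rows M (B j) T|) t.-1.
  rewrite prednK // => pm.
  apply: (@leq_trans ((\sum_(j in hit T) #|common_rows M (B j) T|) ^ t)).
    by rewrite leq_exp2r.
  apply: leq_trans pm _; rewrite leq_mul //.
    case: (t.-1) => // t'; rewrite leq_exp2r // (eq_card (B := hit T)) //; exact: leqW (ltnW gT).
  by rewrite [leqLHS]big_mkcond; apply: leq_sum => j _; case: ifP.
have K_gt0 : 0 < #|'I_K| by rewrite card_ord.
have [|j _ avg] := @average_ge 'I_K predT (fun j => 2 * k.+1 ^ t.-1 * K * cliques t M (B j))
  (cliques t M I) K_gt0.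
  have le_S : cliques t M I <= 2 * k.+1 ^ t.-1 * \sum_j cliques t M (B j).
    by rewrite -mulnA; apply: leq_trans good_half _; rewrite leq_mul2l.
  by rewrite card_ord -big_distrr /= [2 * _ * K]mulnC -mulnA leq_mul2l le_S orbT.
by exists (a + j * h).
Qed.

(** The condition [c * K <= K ^ t] passes the density threshold on to the chosen block: if that
    block fell below it, the larger block would have been below its own threshold. *)
Lemma cliques_block_iter (n t c D K : nat) (M : 'M[bool]_n) :
  0 < t -> c * K <= K ^ t ->
  (forall a h, D * (K * h) ^ t <= cliques t M (block n a (K * h)) ->
    exists a', cliques t M (block n a (K * h)) <= c * K * cliques t M (block n a' h)) ->
  forall s a, D * (K ^ s) ^ t <= cliques t M (block n a (K ^ s)) ->
    cliques t M (block n a (K ^ s)) <= (c * K) ^ s * n ^ t.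
Proof.
move=> t0 cK step; elim=> [|s IH] a.
  (* In a single row each of the [n ^ t] tuples has at most one common row. *)
  move=> _; rewrite !expn0 mul1n.
  apply: (@leq_trans (\sum_(T : {ffun 'I_t -> 'I_n}) 1)); last by rewrite sum1_card card_ffun !card_ord.
  apply: leq_sum => T _; rewrite -[leqRHS](exp1n t) leq_exp2r //.
  apply: leq_trans (card_block n a 1); apply: subset_leq_card.
  by apply/subsetP => r /setIdP[].
rewrite expnS => large; have [a' le_a'] := step _ _ large.
case: (leqP (D * (K ^ s) ^ t) (cliques t M (block n a' (K ^ s)))) => [/IH le_s|small].
  by rewrite expnS -mulnA; apply: leq_trans le_a' _; rewrite leq_mul.
case: (posnP (c * K)) => [cK0|cK_gt0]; first by rewrite cK0 in le_a' *; apply: leq_trans le_a' _; rewrite mul0n.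
have : c * K * cliques t M (block n a' (K ^ s)) < c * K * (D * (K ^ s) ^ t) by rewrite ltn_pmul2l.
have : c * K * (D * (K ^ s) ^ t) <= D * (K * K ^ s) ^ t.
  by rewrite expnMn mulnCA leq_mul2l leq_mul2r cK !orbT.
lia.
Qed.

(** * Bounds on the weight *)

Lemma weight_columns (n : nat) (M : 'M[bool]_n) : weight M = \sum_v #|[set r | M r v]|.
Proof.
rewrite /weight -sum1_card; under [RHS]eq_bigr => v _ do rewrite -sum1_card.
rewrite pair_big_dep /= (reindex_onto (fun p => (p.2, p.1)) (fun p => (p.2, p.1))) /=; last by case.
by apply: eq_bigl => -[v r]; rewrite !inE eqxx andbT.
Qed.

(** Convexity is used twice: over columns, to count pairs of a column and a [t]-tuple of its rows,
    then over the [t]-tuples of rows. As [n <= h], the block contains all rows. *)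
Lemma weight_cliques (n t h : nat) (M : 'M[bool]_n) : 0 < t -> n <= h ->
  weight M ^ (t * t) <= n ^ (2 * t * t.-1) * cliques t M (block n 0 h).
Proof.
case: t => // t _ nh.
have sumR : \sum_(R in ffun_on (block n 0 h)) #|common_cols (t := t.+1) M R| =
    \sum_v #|[set r | M r v]| ^ t.+1.
  under [LHS]eq_bigr => R _ do rewrite -sum1_card.
  rewrite (exchange_big_dep (fun _ : 'I_n => true)) //=; apply: eq_bigr => v _.
  rewrite -[X in _ ^ X](card_ord t.+1) -card_ffun_on -sum1_card; apply: eq_bigl => R.
  rewrite [X in _ && X]inE; apply/andP/ffun_onP => [[_ /forallP MR] i|MR]; first by rewrite inE MR.
  split; last by apply/forallP => i; have := MR i; rewrite inE.
  by apply/ffun_onP => i; rewrite inE /=; apply: leq_trans (ltn_ord _) nh.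
have w1 : weight M ^ t.+1 <= n ^ t * \sum_(R in ffun_on (block n 0 h)) #|common_cols (t := t.+1) M R|.
  have := power_mean predT (fun v => #|[set r | M r v]|) t.
  by rewrite sumR weight_columns card_ord.
have w2 := power_mean (mem (ffun_on (block n 0 h))) (fun R => #|common_cols (t := t.+1) M R|) t.
rewrite expnM (leq_trans (_ : _ <= (n ^ t * \sum_(R in ffun_on (block n 0 h)) #|common_cols (t := t.+1) M R|) ^ t.+1)) //.
  by rewrite leq_exp2r.
rewrite expnMn (leq_trans (leq_mul (leqnn _) w2)) // -cliquesE mulnA leq_mul2r.
apply/orP; right; rewrite (@card_ffun_on 'I_t.+1) card_ord /=.
apply: (@leq_trans ((n ^ t) ^ t.+1 * (n ^ t.+1) ^ t)).
  rewrite leq_mul2l; apply/orP; right; case: (t) => // t'; rewrite leq_exp2r // leq_exp2r //.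
  by rewrite -[leqRHS](card_ord n); apply: max_card.
by rewrite -!expnM -expnD leq_eqVlt; apply/orP; left; apply/eqP; congr (_ ^ _); nia.
Qed.

(* Taking [K] to be the [e]-th power of the loss factor [c] of one step makes the
   total loss over [log_K n] steps about [n ^ (1 / e)]. *)
Lemma weight_bound (t k l e : nat) (A : 'M[bool]_(k, l)) :
  1 < t -> column_partite t A -> 0 < e ->
  exists C, forall (n : nat) (M : 'M[bool]_n), ~~ containsb M A ->
    weight M ^ (t * t * e) <= C * n ^ ((2 * t * t.-1 + t.+1) * e + 1).
Proof.
move=> t1 Apart e0; have t0 := ltnW t1.
pose c := 2 * k.+1 ^ t.-1; pose K := c ^ e.
have c1 : 1 < c by rewrite /c; have := expn_gt0 k.+1 t.-1; lia.
have K1 : 1 < K by rewrite /K -[ltnLHS](exp1n e) ltn_exp2r.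
have [D step] := cliques_block_step t0 (ltnW K1) Apart.
have cK : c * K <= K ^ t.
  apply: (@leq_trans (K ^ 2)); last by rewrite leq_pexp2l // ltnW.
  have cK : c <= K by rewrite /K -{1}(expn1 c) leq_pexp2l // ltnW.
  by rewrite expnS expn1 leq_mul2r cK orbT.
(* The first summand serves the case where the whole matrix is below the density threshold, the
   second the case where the descent applies. *)
exists ((D * K ^ t) ^ e + K ^ e.+1) => n M Afree.
have [n0|n0] := posnP n.
  suff -> : weight M = 0 by rewrite exp0n // !muln_gt0 t0 e0.
  by apply: eq_card0 => -[[i ilt] j]; exfalso; move: ilt; rewrite n0.
have /andP[Kn nK] := trunc_log_bounds K1 n0; set s := (trunc_log K n).+1 in nK.
have Ks : K ^ s <= K * n by rewrite expnS leq_mul2l Kn orbT.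
have wS := weight_cliques M t0 (ltnW nK); set S := cliques _ _ _ in wS.
rewrite expnM mulnDl; have wSe : (weight M ^ (t * t)) ^ e <= (n ^ (2 * t * t.-1) * S) ^ e by rewrite leq_exp2r.
apply: leq_trans wSe _.
case: (leqP (D * (K ^ s) ^ t) S) => [large|small].
  apply: leq_trans (leq_addl _ _).
  have le_S := cliques_block_iter t0 cK (fun a h => step n M a h Afree) large.
  rewrite -/S in le_S.
  (* Since [K = c ^ e], the left side is [K ^ s]: the total loss, raised to the power [e], costs
     only one factor [n] up to a constant. *)
  have cs : c ^ (s * e) <= K * n by rewrite mulnC expnM.
  have -> : K ^ e.+1 * n ^ ((2 * t * t.-1 + t.+1) * e + 1) =
      (n ^ (2 * t * t.-1)) ^ e * ((n ^ t) ^ e * (K * n) ^ e * (K * n)).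
    have -> : n ^ ((2 * t * t.-1 + t.+1) * e + 1) = (n ^ (2 * t * t.-1)) ^ e * (n ^ t) ^ e * n ^ e * n.
      rewrite -!expnM -!expnD -expnSr; congr (_ ^ _); rewrite mulnDl mulSn; lia.
    rewrite expnMn [K ^ e.+1]expnS.
    by move: (n ^ _) (n ^ _) (n ^ _) (K ^ _) => *; nia.
  rewrite expnMn leq_mul2l; apply/orP; right.
  apply: (@leq_trans (((c * K) ^ s * n ^ t) ^ e)); first by rewrite leq_exp2r.
  rewrite expnMn mulnC -mulnA leq_mul2l; apply/orP; right.
  rewrite expnMn expnMn -[(c ^ s) ^ e]expnM mulnC leq_mul // leq_exp2r //.
apply: leq_trans (leq_addr _ _).
apply: (@leq_trans ((n ^ (2 * t * t.-1) * (D * (K * n) ^ t)) ^ e)).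
  rewrite leq_exp2r // leq_mul2l; apply/orP; right; apply: leq_trans (ltnW small) _.
  by rewrite leq_mul2l leq_exp2r // Ks orbT.
have -> : n ^ (2 * t * t.-1) * (D * (K * n) ^ t) = D * K ^ t * n ^ (2 * t * t.-1 + t).
  by rewrite expnMn expnD; nia.
rewrite expnMn leq_mul2l -expnM; apply/orP; right; rewrite leq_pexp2l //; nia.
Qed.

(** * Passage to real exponents *)

Lemma INR_expn (a b : nat) : INR (a ^ b) = (INR a ^ b)%R.
Proof. by elim: b => //= b IH; rewrite expnS -multE mult_INR IH. Qed.

(** Divided by [t * t * e], the exponent in [weight_bound] exceeds [2 - 1/t + 1/t^2] by
    [1 / (t^2 * e)]. One more factor [n] absorbs [C], so the total excess is [2 / (t^2 * e)], which
    is below [eps] once [e > 2 / eps]. *)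
Theorem theorem2p1 (t k l : nat) (A : 'M[bool]_(k, l)) :
  (2 <= t)%N -> column_partite t A ->
  forall eps : R, (0 < eps)%R ->
  exists n0 : nat, forall n : nat, (n0 <= n)%N ->
    (INR (ex n A) < Rpower (INR n) (2 - 1 / INR t + 1 / (INR t ^ 2) + eps))%R.
Proof.
move=> t2 Apart eps eps0.
have [e He] := INR_unbounded (2 / eps).
have eps_e : (2 < eps * INR e)%R.
  by apply: (Rmult_lt_reg_r (/ eps)); [exact: Rinv_0_lt_compat | field_simplify; lra].
have e0 : 0 < e by case: e eps_e {He} => //=; rewrite Rmult_0_r; lra.
have [C HC] := weight_bound t2 Apart e0.
exists C.+1 => n Cn; set x := (_ + eps)%R; set q := ((2 * t * t.-1 + t.+1) * e + 1) in HC.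
set w := ex n A.
have p0 : 0 < t * t * e by rewrite !muln_gt0 e0 ltnW.
have wC : w ^ (t * t * e) <= C * n ^ q.
  rewrite /w /ex; apply: (big_ind (fun w => w ^ (t * t * e) <= C * n ^ q)) => [|a b|M] //.
    by rewrite exp0n.
    by rewrite /maxn; case: ifP.
  exact: HC.
have n1 : (1 <= INR n)%R by apply: (le_INR 1); lia.
have CnR : (INR C < INR n)%R by apply: lt_INR; lia.
(* Otherwise [n ^ q.+1] would be at most [w ^ (t * t * e)], hence at most [C * n ^ q], against
   [C < n]. *)
apply: Rnot_le_lt => xw.
have wCR : (INR w ^ (t * t * e) <= INR C * INR n ^ q)%R.
  by rewrite -!INR_expn -mult_INR; apply: le_INR; apply/leP.
have pow_x : (Rpower (INR n) x ^ (t * t * e) <= INR w ^ (t * t * e))%R.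
  by apply: pow_incr; split=> //; apply/Rlt_le/exp_pos.
have ltn : (INR C * INR n ^ q < INR n ^ q.+1)%R.
  by rewrite /=; apply: Rmult_lt_compat_r => //; apply: pow_lt; lra.
have : (Rpower (INR n) (INR q.+1) <= Rpower (INR n) (x * INR (t * t * e)))%R.
  apply: Rle_Rpower => //.
  rewrite S_INR /q -!plusE -!multE !plus_INR !mult_INR !plus_INR !mult_INR.
  rewrite !S_INR.
  have -> : INR t.-1 = (INR t - 1)%R by case: (t) t2 => // t' _; rewrite S_INR /=; lra.
  have tR : (2 <= INR t)%R by apply: (le_INR 2); apply/leP.
  have -> : (x * (INR t * INR t * INR e) =
     (2 * INR t * INR t - INR t + 1) * INR e + INR t * INR t * (eps * INR e))%R.
    by rewrite /x; field; lra.
  have : (1 <= INR t * INR t)%R by nra.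
  have -> : INR 0 = 0%R by []. nra.
rewrite -Rpower_mult !Rpower_pow //; try lra; last exact: exp_pos.
Qed.
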